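(* For every odd integer $n\geqslant 3$, there exists an irreducible $n$-ary semigroup to which a neutral element can be adjoined. In particular, for odd $n$, the implication ''if a neutral element can be adjoined to an $n$-ary semigroup, then the $n$-ary semigroup is reducible to a binary semigroup'' is false.
   Context: Let $n\geqslant 2$ be an integer. An $n$-ary semigroup is a pair $(X,F)$, where $X$ is a nonempty set and $F\colon X^n\to X$ is associative, i.e. $$F(x_1,\ldots,x_{i-1},F(x_i,\ldots,x_{i+n-1}),x_{i+n},\ldots,x_{2n-1})=F(x_1,\ldots,x_i,F(x_{i+1},\ldots,x_{i+n}),x_{i+n+1},\ldots,x_{2n-1})$$ for all $x_1,\ldots,x_{2n-1}\in X$ and all $1\leqslant i\leqslant n-1$. $(X,F)$ is reducible to a (binary) semigroup $(X,\circ)$ on the same set if $F(x_1,\ldots,x_n)=x_1\circ x_2\circ\cdots\circ x_n$ for all $x_1,\ldots,x_n\in X$. It is reducible if it is reducible to some semigroup $(X,\circ)$, and irreducible otherwise. An element $e\in X$ is neutral for $F$ if, for every $x\in X$ and every $k\in\{1,\ldots,n\}$, $F(e^{k-1},x,e^{n-k})=x$, where $e^j$ denotes the list $e,\ldots,e$ with $j$ copies of $e$. A neutral element can be adjoined to $(X,F)$ if there exists an $n$-ary semigroup $(X^*,F^* )$, where $X^*=X\cup\{e\}$ for some $e\notin X$, such that $F^*|_{X^n}=F$ and $e$ is neutral for $F^*$. *)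

(* Defs.v *)
From mathcomp Require Import all_boot zify.

Set Implicit Arguments.
Unset Strict Implicit.
Unset Printing Implicit Defensive.

Lemma size_window (n : nat) (X : Type) (x : (2 * n - 1).-tuple X) (i : 'I_n) :
  size (take n (drop i x)) == n.
Proof. by have lt_in := ltn_ord i; rewrite size_take_min size_drop size_tuple; lia. Qed.

(* For x = (x_1, ..., x_(2n-1)) and 0 <= i < n, the word x_(i+1), ..., x_(i+n). *)
Definition window (n : nat) (X : Type) (x : (2 * n - 1).-tuple X) (i : 'I_n) :
    n.-tuple X :=
  Tuple (size_window x i).

Lemma size_contract (n : nat) (X : Type) (F : n.-tuple X -> X)
    (x : (2 * n - 1).-tuple X) (i : 'I_n) :
  size (take i x ++ F (window x i) :: drop (i + n) x) == n.
Proof.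
have lt_in := ltn_ord i.
by rewrite size_cat /= size_take_min size_drop size_tuple; lia.
Qed.

(* The word x_1, ..., x_i, F(x_(i+1), ..., x_(i+n)), x_(i+n+1), ..., x_(2n-1). *)
Definition contract (n : nat) (X : Type) (F : n.-tuple X -> X)
    (x : (2 * n - 1).-tuple X) (i : 'I_n) : n.-tuple X :=
  Tuple (size_contract F x i).

Definition nary_associative (n : nat) (X : Type) (F : n.-tuple X -> X) : Prop :=
  forall (x : (2 * n - 1).-tuple X) (i j : 'I_n),
    j = i.+1 :> nat -> F (contract F x i) = F (contract F x j).

Definition nary_semigroup (n : nat) (X : Type) (F : n.-tuple X -> X) : Prop :=
  inhabited X /\ nary_associative F.

(* For n >= 1 every n-tuple has exactly one decomposition y :: s, and
   foldl op y s is the left-bracketed product of its entries. *)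
Definition reducible_to (n : nat) (X : Type) (F : n.-tuple X -> X)
    (op : X -> X -> X) : Prop :=
  forall (x : n.-tuple X) (y : X) (s : seq X),
    x = y :: s :> seq X -> F x = foldl op y s.

Definition reducible (n : nat) (X : Type) (F : n.-tuple X -> X) : Prop :=
  exists op : X -> X -> X, associative op /\ reducible_to F op.

Definition irreducible (n : nat) (X : Type) (F : n.-tuple X -> X) : Prop :=
  ~ reducible F.

Definition nary_neutral (n : nat) (X : Type) (F : n.-tuple X -> X) (e : X) :
    Prop :=
  forall (x : X) (k : 'I_n), F [tuple if j == k then x else e | j < n] = x.

(* The set X together with a new element e is option X, with e = None. *)
Definition neutral_adjoinable (n : nat) (X : Type) (F : n.-tuple X -> X) :
    Prop :=
  exists Fs : n.-tuple (option X) -> option X,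
    [/\ nary_semigroup Fs,
        forall x : n.-tuple X, Fs [tuple of map Some x] = Some (F x)
      & nary_neutral Fs None].

(* Main.v *)
Require Import Defs.
From mathcomp Require Import all_boot.
From HB Require Import structures.

(** The full transformation monoid of a two-element set consists of the
    identity, the swap and the two constant maps.  The identity is a product
    of other elements only as an even power of the swap, so for odd [n] the
    three other elements are closed under [n]-fold products.  They form an
    [n]-ary semigroup, and the identity can be adjoined to it.

    Suppose that this [n]-ary product were an iterated product for some binary
    semigroup operation.  The [n-1]-st power of the swap is the identity, so in
    the binary semigroup that power has to be a unit ([reducible_has_neutral]);
    it is then neutral for the [n]-ary product.  But none of the three
    elements is: products that start with a constant are constant, and the
    swap does not commute with the constants ([swap_const_no_neutral]). *)

Set Implicit Arguments.
Unset Strict Implicit.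
Unset Printing Implicit Defensive.

(** * Iterated products in a monoid *)

Section MonoidProduct.

Variables (M : Type) (e : M) (op : Monoid.law e).

Definition nary_prod n (x : n.-tuple M) : M := \big[op/e]_(y <- x) y.

Lemma nary_prod_contract n (x : (2 * n - 1).-tuple M) (i : 'I_n) :
  nary_prod (contract (@nary_prod n) x i) = \big[op/e]_(y <- x) y.
Proof.
rewrite /nary_prod /= big_cat big_cons /= -big_cat /=.
by rewrite addnC -drop_drop cat_take_drop -big_cat /= cat_take_drop.
Qed.

Lemma nary_prod_associative n : nary_associative (@nary_prod n).
Proof. by move=> x i j _; rewrite !nary_prod_contract. Qed.

Lemma nary_prod_neutral n : nary_neutral (@nary_prod n) e.
Proof.
move=> x k; rewrite /nary_prod big_map val_ord_tuple -big_mkcond -big_filter.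
by rewrite filter_pred1_uniq ?enum_uniq ?mem_enum // big_seq1.
Qed.

End MonoidProduct.

(** * Subsystems and reducible operations *)

(** Associativity is inherited by subsystems, since forming a contracted word
    commutes with an embedding. *)
Lemma nary_associative_inj n (X Y : Type) (h : X -> Y) (F : n.-tuple X -> X)
    (G : n.-tuple Y -> Y) :
    injective h -> (forall x : n.-tuple X, G [tuple of map h x] = h (F x)) ->
  nary_associative G -> nary_associative F.
Proof.
move=> h_inj GF Gassoc x i j ij; apply: h_inj; rewrite -!GF.
have mapC k :
    [tuple of map h (contract F x k)] = contract G [tuple of map h x] k.
  apply: val_inj; rewrite /= map_cat /= map_take map_drop -GF.
  congr (_ ++ G _ :: _); apply: val_inj.
  by rewrite /= map_take map_drop.
by rewrite !mapC; apply: Gassoc.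
Qed.

(** In a semigroup where [a ^ (n-1)] acts trivially on both sides, this power
    is a unit, and a unit of the semigroup is neutral for iterated products. *)
Lemma reducible_has_neutral m (X : Type) (F : m.+2.-tuple X -> X) (a : X) :
    reducible F ->
    (forall x, F [tuple of rcons (nseq m.+1 a) x] = x) ->
    (forall x, F [tuple of x :: nseq m.+1 a] = x) ->
  exists u, nary_neutral F u.
Proof.
move=> [op [opA redF]] aL aR.
have opA_foldl y z s : foldl op (op y z) s = op y (foldl op z s).
  by elim: s z => //= t s IHs z; rewrite -opA IHs.
pose u := foldl op a (nseq m a); exists u.
have uL : left_id u op.
  by move=> x; rewrite -[RHS]aL (redF _ a (rcons (nseq m a) x)) // foldl_rcons.
have uR : right_id u op.
  by move=> x; rewrite -[RHS]aR (redF _ x (nseq m.+1 a)) //= opA_foldl.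
pose opM : Monoid.law u := HB.pack op (Monoid.isLaw.Build X u op opA uL uR).
move=> x k; rewrite -[RHS](nary_prod_neutral opM x k).
case: {x k}(mktuple _) => -[|y s] // ys.
by rewrite (redF _ y s) // /nary_prod -(foldl_idx opM) /= uL.
Qed.

(** * Transformations of a two-element set *)

Definition swap_const : Type := option bool.
Definition swap : swap_const := None.
Definition const (c : bool) : swap_const := Some c.

(** Composition of transformations of [bool], right factor first; [None] is
    the identity map. *)
Definition comp_trans (f g : option swap_const) : option swap_const :=
  match f, g with
  | None, _ => g
  | _, None => f
  | Some (Some c), _ => Some (const c)
  | Some None, Some None => None
  | Some None, Some (Some c) => Some (const (~~ c))
  end.

Lemma comp_transA : associative comp_trans.
Proof. by move=> [[[]|]|] [[[]|]|] [[[]|]|]. Qed.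

Lemma comp_trans1l : left_id None comp_trans.
Proof. by []. Qed.

Lemma comp_trans1r : right_id None comp_trans.
Proof. by move=> [[[]|]|]. Qed.

HB.instance Definition _ :=
  Monoid.isLaw.Build (option swap_const) None comp_trans
    comp_transA comp_trans1l comp_trans1r.

Definition trans_prod (w : seq swap_const) : option swap_const :=
  \big[comp_trans/None]_(f <- map Some w) f.

Lemma trans_prod_nil : trans_prod [::] = None.
Proof. by rewrite /trans_prod big_nil. Qed.

Lemma trans_prod_cons f w :
  trans_prod (f :: w) = comp_trans (Some f) (trans_prod w).
Proof. by rewrite /trans_prod /= big_cons. Qed.

Lemma trans_prod_rcons w f :
  trans_prod (rcons w f) = comp_trans (trans_prod w) (Some f).
Proof.
by rewrite /trans_prod map_rcons -cats1 big_cat big_seq1.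
Qed.

(** A bijective product has only swaps as factors, so it is determined by the
    parity of the length; the claim about the swap feeds the induction. *)
Lemma trans_prod_parity w :
  match trans_prod w with
  | None => ~~ odd (size w)
  | Some None => odd (size w)
  | Some (Some _) => true
  end.
Proof.
elim: w => [|f w]; first by rewrite trans_prod_nil.
rewrite trans_prod_cons /=.
by case: f (trans_prod w) => [c|] [[d|]|]; rewrite /= ?negbK.
Qed.

Lemma trans_prod_swaps k : ~~ odd k -> trans_prod (nseq k swap) = None.
Proof.
move=> k_even; have -> : k = k./2.*2 by rewrite even_halfK.
elim: k./2 => [|j IHj]; first by rewrite trans_prod_nil.
by rewrite doubleS /= !trans_prod_cons IHj.
Qed.

Definition swap_const_prod n (x : n.-tuple swap_const) : swap_const :=
  odflt swap (trans_prod x).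

(** For odd [n] the default value in [swap_const_prod] is never reached. *)
Lemma Some_swap_const_prod n (x : n.-tuple swap_const) :
  odd n -> Some (swap_const_prod x) = trans_prod x.
Proof.
move=> n_odd; rewrite /swap_const_prod.
by have := trans_prod_parity x; rewrite size_tuple n_odd; case: (trans_prod x).
Qed.

Lemma swap_const_semigroup n : odd n -> nary_semigroup (@swap_const_prod n).
Proof.
move=> n_odd; split; first exact: inhabits swap.
apply: (nary_associative_inj (h := Some)
          (G := @nary_prod _ _ comp_trans n)).
- by move=> ? ? [].
- by move=> x; rewrite Some_swap_const_prod.
- exact: nary_prod_associative.
Qed.

Lemma swap_const_adjoinable n :
  odd n -> neutral_adjoinable (@swap_const_prod n).
Proof.
move=> n_odd; exists (@nary_prod _ _ comp_trans n); split.
- by split; [exact: inhabits None | exact: nary_prod_associative].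
- by move=> x; rewrite Some_swap_const_prod.
- exact: nary_prod_neutral.
Qed.

(** With [u] in all positions but the second: for constant [u], the swap in
    second position yields a constant; for [u] the swap, a constant there
    yields the other constant. *)
Lemma swap_const_no_neutral n (u : swap_const) :
  2 <= n -> ~ nary_neutral (@swap_const_prod n) u.
Proof.
case: n => [|[|m]] // _ neutral_u.
have {neutral_u}E x : exists w, odflt swap (trans_prod [:: u, x & w]) = x.
  have := neutral_u x (lift ord0 ord0).
  by rewrite /swap_const_prod /= !enum_ordSl /=; eexists; eassumption.
case: u E => [c|] E.
- have [w] := E swap; rewrite !trans_prod_cons.
  by case: (trans_prod w) => [[]|].
- have [w] := E (const true); rewrite !trans_prod_cons.
  by case: (trans_prod w) => [[]|].
Qed.

Lemma swap_const_irreducible n :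
  odd n -> 2 <= n -> irreducible (@swap_const_prod n).
Proof.
move=> n_odd n_ge2 redF.
have [] : exists u, nary_neutral (@swap_const_prod n) u; last first.
  by move=> u; apply: swap_const_no_neutral.
case: n n_odd n_ge2 redF => [|[|m]] // n_odd _ redF.
have swaps : trans_prod (nseq m.+1 swap) = None by exact: trans_prod_swaps.
apply: (reducible_has_neutral (a := swap) redF) => x; apply: Some_inj.
- by rewrite Some_swap_const_prod // trans_prod_rcons swaps.
- by rewrite Some_swap_const_prod // trans_prod_cons swaps comp_trans1r.
Qed.

Theorem mainTheorem1 (n : nat) (n_odd : odd n) (n_ge3 : 3 <= n) :
  (exists (X : Type) (F : n.-tuple X -> X),
     [/\ nary_semigroup F, irreducible F & neutral_adjoinable F])
  /\
  ~ (forall (X : Type) (F : n.-tuple X -> X),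
       nary_semigroup F -> neutral_adjoinable F -> reducible F).
Proof.
have sg := swap_const_semigroup n_odd.
have irr := swap_const_irreducible n_odd (ltnW n_ge3).
have adj := swap_const_adjoinable n_odd.
split; first by exists swap_const, (@swap_const_prod n).
by move=> all_red; apply: irr; apply: all_red.
Qed.
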